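(* Let two particles $i,j$ with energies $E_i,E_j\in\mathbb{R}\setminus\{0\}$ and momenta $P_i,P_j\in\mathbb{R}$ undergo a collision (as defined in the context), and suppose that the squared mass of particle $i$ satisfies $\mu_i=E_i^2-P_i^2\ge0$. Then the energy of particle $i$ changes its sign during the collision (i.e. $E_iE_i'<0$, where $E_i'$ is its energy after the collision) if and only if the collision is tachyonic.
   Context: Units are such that the speed of light is $1$. A particle on the real line has energy $E\in\mathbb{R}\setminus\{0\}$, momentum $P\in\mathbb{R}$, velocity $v=P/E$ and squared mass $\mu=E^2-P^2$; energies may have either sign. For each particle put $\sigma=E+P$ and $\rho=E-P$, so that $\sigma\rho=\mu$ and $2E=\sigma+\rho$. When particles $i,j$ with $v_i\ne v_j$ collide, put $s=\sigma_i+\sigma_j$, $r=\rho_i+\rho_j$; it is assumed that $sr\neq0$, and the post-collision values (marked by primes) are $\sigma_i'=\rho_i s/r$, $\rho_i'=\sigma_i r/s$, $\sigma_j'=\rho_j s/r$, $\rho_j'=\sigma_j r/s$, with $2E_*'=\sigma_*'+\rho_*'$ for $*=i,j$. (Total energy, total momentum and each squared mass are preserved.) The collision is called tachyonic if $sr=(E_i+E_j)^2-(P_i+P_j)^2<0$. *)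

(* Defs.v *)
From Stdlib Require Import Reals.
Open Scope R_scope.

(* Energies may have either sign; the speed of light is 1. *)
Record particle : Type := Particle {
  energy : R;
  momentum : R;
  energy_neq0 : energy <> 0
}.

Definition velocity (p : particle) : R := momentum p / energy p.

Definition squared_mass (p : particle) : R := energy p ^ 2 - momentum p ^ 2.

Definition sigma (p : particle) : R := energy p + momentum p.
Definition rho (p : particle) : R := energy p - momentum p.

Definition total_sigma (i j : particle) : R := sigma i + sigma j.
Definition total_rho (i j : particle) : R := rho i + rho j.

Definition collision (i j : particle) : Prop :=
  velocity i <> velocity j /\ total_sigma i j * total_rho i j <> 0.

(* The post-collision values below are those of the first argument, p, after
   its collision with q; the totals are symmetric, so the values of the other
   particle are obtained by exchanging the arguments.  They are real numbers
   and not a [particle], because the energy after a collision is not assumed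
   to be nonzero. *)
Definition sigma_after (p q : particle) : R :=
  rho p * total_sigma p q / total_rho p q.
Definition rho_after (p q : particle) : R :=
  sigma p * total_rho p q / total_sigma p q.
Definition energy_after (p q : particle) : R :=
  (sigma_after p q + rho_after p q) / 2.

(* The left-hand side equals [total_sigma i j * total_rho i j]. *)
Definition tachyonic (i j : particle) : Prop :=
  (energy i + energy j) ^ 2 - (momentum i + momentum j) ^ 2 < 0.

(* Main.v *)
(** Write [s], [r] for the totals of sigma and rho.  Then
    [4 s r E E' = mu (s^2 + r^2) + (rho s)^2 + (sigma r)^2], which is positive
    because [mu >= 0], [s r <> 0], and [sigma], [rho] are not both zero (their
    sum is [2 E]).  Hence [E E'] has the sign of [s r]. *)

Require Import Defs.
From Stdlib Require Import Reals Lra.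
Open Scope R_scope.

(** Over a common denominator [2 E' = (rho s^2 + sigma r^2) / (s r)], so with [2 E = sigma + rho]
    the left side is [(sigma + rho) (rho s^2 + sigma r^2)]. Its cross terms collect to
    [sigma rho (s^2 + r^2)], and [sigma rho = mu]. *)
Lemma energy_product_identity (p q : particle) :
  total_sigma p q * total_rho p q <> 0 ->
  4 * (total_sigma p q * total_rho p q) * (energy p * energy_after p q) =
  squared_mass p * (total_sigma p q ^ 2 + total_rho p q ^ 2)
  + (rho p * total_sigma p q) ^ 2 + (Defs.sigma p * total_rho p q) ^ 2.
Proof.
  intros Hsr.
  replace (energy p) with ((Defs.sigma p + rho p) / 2) by (unfold Defs.sigma, rho; field).
  replace (squared_mass p) with (Defs.sigma p * rho p)
    by (unfold squared_mass, Defs.sigma, rho; ring).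
  unfold energy_after, sigma_after, rho_after.
  field; split; intros H; apply Hsr; rewrite H; ring.
Qed.

Lemma energy_product_pos (p q : particle) :
  total_sigma p q * total_rho p q <> 0 ->
  0 <= squared_mass p ->
  0 < 4 * (total_sigma p q * total_rho p q) * (energy p * energy_after p q).
Proof.
  intros Hsr Hmu.
  rewrite (energy_product_identity p q Hsr).
  assert (Hs : total_sigma p q <> 0) by (intros H; apply Hsr; rewrite H; ring).
  assert (Hr : total_rho p q <> 0) by (intros H; apply Hsr; rewrite H; ring).
  assert (0 <= squared_mass p * (total_sigma p q ^ 2 + total_rho p q ^ 2))
    by (apply Rmult_le_pos; nra).
  (* The split decides which square is strictly positive: if [rho = 0], then [sigma = 2 E] is
     nonzero and the second one is; otherwise the first. *)
  destruct (Req_dec (rho p) 0) as [Hrho | Hrho].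
  - assert (Hsigma : Defs.sigma p <> 0).
    { intros Hsigma; apply (energy_neq0 p); unfold Defs.sigma, rho in *; lra. }
    assert (0 < (Defs.sigma p * total_rho p q) ^ 2)
      by (rewrite <- Rsqr_pow2; apply Rlt_0_sqr, Rmult_integral_contrapositive_currified; assumption).
    assert (0 <= (rho p * total_sigma p q) ^ 2) by apply pow2_ge_0.
    lra.
  - assert (0 < (rho p * total_sigma p q) ^ 2)
      by (rewrite <- Rsqr_pow2; apply Rlt_0_sqr, Rmult_integral_contrapositive_currified; assumption).
    assert (0 <= (Defs.sigma p * total_rho p q) ^ 2) by apply pow2_ge_0.
    lra.
Qed.

Theorem proposition11 (i j : particle)
  (Hcol : collision i j)
  (Hmu : 0 <= squared_mass i) :
  energy i * energy_after i j < 0 <-> tachyonic i j.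
Proof.
  destruct Hcol as [_ Hsr].
  assert (Hpos := energy_product_pos i j Hsr Hmu).
  unfold tachyonic.
  replace ((energy i + energy j) ^ 2 - (momentum i + momentum j) ^ 2)
    with (total_sigma i j * total_rho i j)
    by (unfold total_sigma, total_rho, Defs.sigma, rho; ring).
  (* If one factor in [Hpos] is negative and the other is not, their product is at most 0, a
     contradiction. *)
  split; intros H; nra.
Qed.
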